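(* Let $\mathcal{C}$ be a pre-modular $\mathsf{G}$-category relative to $(\mathsf{Z},\mathsf{X})$ (in the sense of the context). If there exists $g\in\mathsf{G}\setminus\mathsf{X}$ such that the corresponding $S$-matrices $S_g$ and $S_{-g,g}$ are non-degenerate (invertible), then $\mathcal{C}$ is non-degenerate, i.e. $\Delta_+\Delta_-\neq 0$.
   Context: Let $\Bbbk$ be a field. A linear ribbon category over $\Bbbk$ is a ribbon category $\mathcal{C}$ with unit $\mathds{1}$ whose Hom-sets are $\Bbbk$-vector spaces, with $\Bbbk$-bilinear composition and tensor product of morphisms, and such that $\Bbbk\to\mathrm{End}(\mathds 1)$, $x\mapsto x\,\mathrm{Id}_{\mathds 1}$, is an isomorphism. The braiding is $c_{V,W}:V\otimes W\to W\otimes V$, the twist is $\theta_V$, the duality morphisms are $\overrightarrow{\mathrm{ev}}_V:V^*\otimes V\to\mathds 1$, $\overrightarrow{\mathrm{coev}}_V:\mathds 1\to V\otimes V^*$, $\overleftarrow{\mathrm{ev}}_V:V\otimes V^*\to\mathds 1$, $\overleftarrow{\mathrm{coev}}_V:\mathds 1\to V^*\otimes V$. An object $V$ is simple if $\mathrm{End}(V)=\Bbbk\,\mathrm{Id}_V$, and regular if its evaluation is an epimorphism. Ideals and m-traces: an ideal $\mathcal I$ of $\mathcal C$ is a full subcategory stable under retracts and such that $U\otimes V\in\mathcal I$ for all $U\in\mathcal I$, $V\in\mathcal C$. An m-trace on $\mathcal I$ is a family of linear maps $\mathsf t_V:\mathrm{End}(V)\to\Bbbk$ ($V\in\mathcal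 I$) with $\mathsf t_V(fg)=\mathsf t_U(gf)$ for $g:V\to U$, $f:U\to V$, $U,V\in\mathcal I$, and $\mathsf t_{U\otimes V}(f)=\mathsf t_U(\mathrm{ptr}_V(f))$ for $U\in\mathcal I$, $V\in\mathcal C$, $f\in\mathrm{End}(U\otimes V)$, where $\mathrm{ptr}_V$ is the right partial trace. The modified dimension of $V\in\mathcal I$ is $\mathsf d(V)=\mathsf t_V(\mathrm{Id}_V)$. Dominating sets: a set of objects $\{V_i\}_{i\in J}$ of a linear category is dominating if every $\mathrm{Id}_V$ is a finite sum $\sum_k \iota_k s_k$ with $s_k:V\to V_{i_k}$, $\iota_k:V_{i_k}\to V$; it is completely reduced if $\dim\mathrm{Hom}(V_i,V_j)=\delta_{i,j}$. Free realisation: for a commutative group $\mathsf Z$ (additive), a free realisation of $\mathsf Z$ in $\mathcal C$ is a set of objects $\{\sigma(k)\}_{k\in\mathsf Z}$ with $\sigma(0)=\mathds 1$, $\sigma(j)\otimes\sigma(k)=\sigma(j+k)$, quantum dimension of $\sigma(k)$ equal to $\pm1$, $\theta_{\sigma(k)}=\mathrm{Id}$, and, for every simple $V\in\mathcal C$, $V\otimes\sigma(k)\cong V$ iff $k=0$. Grading: for a commutative group $\mathsf G$, a $\mathsf G$-grading is an equivalence $\mathcal C\cong\bigoplus_{g\in\mathsf G}\mathcal C_g$ with full subcategories $\mathcal C_g$ such that $\mathds 1\in\mathcal C_0$; $V\in\mathcal C_g\Rightarrow V^*\in\mathcal C_{-g}$; $\mathcal C_g\otimes\mathcal C_{g'}\subset\mathcal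 C_{g+g'}$; and $\mathrm{Hom}(V,V')\ne0$ with $V\in\mathcal C_g,V'\in\mathcal C_{g'}$ implies $g=g'$. Each $\mathcal C_g$ is assumed to contain an object $V$ with $\mathrm{Id}_V\neq0$. A subset $\mathsf X\subset\mathsf G$ is symmetric if $\mathsf X=-\mathsf X$ and small if $\bigcup_{i=1}^n(g_i+\mathsf X)\ne\mathsf G$ for all $g_1,\dots,g_n\in\mathsf G$. Pre-modular: let $\mathsf X\subset\mathsf G$ be small symmetric. A pre-modular $\mathsf G$-category relative to $(\mathsf Z,\mathsf X)$ is a linear ribbon category $\mathcal C$ with a $\mathsf G$-grading, a free realisation $\{\sigma(k)\}_{k\in\mathsf Z}$ in $\mathcal C_0$, and a non-zero m-trace $\mathsf t$ on the ideal of projective objects, such that: (Generic semisimplicity) for every $g\in\mathsf G\setminus\mathsf X$ there is a finite set of regular simple objects $\Theta(g)=\{V_i\mid i\in I_g\}$ such that $\{V_i\otimes\sigma(k)\mid i\in I_g,k\in\mathsf Z\}$ is a completely reduced dominating set for $\mathcal C_g$; (Compatibility) there is a bilinear map $\psi:\mathsf G\times\mathsf Z\to\Bbbk^*$ with $c_{\sigma(k),V}\circ c_{V,\sigma(k)}=\psi(g,k)\,\mathrm{Id}_{V\otimes\sigma(k)}$ for $V\in\mathcal C_g$, $k\in\mathsf Z$. $S$-matrices: for $U,V\in\mathcal C$ let $\Phi_{U,V}=\mathrm{ptr}_U(c_{U,V}\circ c_{V,U})\in\mathrm{End}(V)$ (the strand $V$ encircled by a closed component coloured $U$). For $g_1,g_2\in\mathsf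 G\setminus\mathsf X$, $i\in I_{g_1}$, $j\in I_{g_2}$ define $S'_{ij}\in\Bbbk$ by $\Phi_{V_i,V_j}=S'_{ij}\mathrm{Id}_{V_j}$ and $S_{ij}=\mathsf d(V_j)S'_{ij}=\mathsf t_{V_j}(\Phi_{V_i,V_j})$. Set $S_{g_1,g_2}=(S_{ij})_{(i,j)\in I_{g_1}\times I_{g_2}}$ and $S_g=S_{g,g}$. Scalars $\Delta_\pm$: for $g\in\mathsf G\setminus\mathsf X$ write $\theta_{V_i}=t_i\mathrm{Id}_{V_i}$ for $i\in I_g$. For every $V\in\mathcal C_g$ one has $\theta_V^{-1}\sum_{i\in I_g}\mathsf d(V_i)t_i^{-1}\Phi_{V_i,V}=\Delta_-\mathrm{Id}_V$ and $\theta_V\sum_{i\in I_g}\mathsf d(V_i)t_i\Phi_{V_i^*,V}=\Delta_+\mathrm{Id}_V$, where the scalars $\Delta_\pm\in\Bbbk$ depend neither on $V$ nor on $g$ (known fact); these define $\Delta_\pm$. $\mathcal C$ is non-degenerate if $\Delta_+\Delta_-\ne0$. *)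

(* Defs.v *)
From HB Require Import structures.
From mathcomp Require Import all_boot all_order all_algebra.

Set Implicit Arguments.
Unset Strict Implicit.
Unset Printing Implicit Defensive.

Import GRing.Theory.
Local Open Scope ring_scope.

Declare Scope cat_scope.
Delimit Scope cat_scope with cat.
Local Open Scope cat_scope.

Reserved Notation "g '∘' f" (at level 45, left associativity).
Reserved Notation "U '⊗' V" (at level 38, left associativity).
Reserved Notation "f '⊗m' g" (at level 38, left associativity).

(** * Linear categories *)

Record linearCategory (k : fieldType) := LinearCategory {
  Ob :> Type;
  Hom : Ob -> Ob -> lmodType k;
  idm : forall V, Hom V V;
  comp : forall {U V W}, Hom V W -> Hom U V -> Hom U W
    where "g '∘' f" := (comp g f);
  comp_idl : forall U V (f : Hom U V), idm V ∘ f = f;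
  comp_idr : forall U V (f : Hom U V), f ∘ idm U = f;
  comp_assoc : forall U V W Y (h : Hom W Y) (g : Hom V W) (f : Hom U V),
    h ∘ (g ∘ f) = (h ∘ g) ∘ f;
  comp_linl : forall U V W (a : k) (g g' : Hom V W) (f : Hom U V),
    (a *: g + g') ∘ f = a *: (g ∘ f) + (g' ∘ f);
  comp_linr : forall U V W (a : k) (g : Hom V W) (f f' : Hom U V),
    g ∘ (a *: f + f') = a *: (g ∘ f) + (g ∘ f')
}.

Arguments Hom {k l} U V : rename.
Arguments idm {k l} V : rename.
Notation "g '∘' f" := (comp g f) : cat_scope.
Notation Endo V := (Hom V V).

Section LinearCategoryNotions.
Context {k : fieldType} {C : linearCategory k}.
Implicit Types U V W : C.

Definition iso_obj U V : Prop :=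
  exists (f : Hom U V) (g : Hom V U), g ∘ f = idm U /\ f ∘ g = idm V.

Definition epi U V (p : Hom U V) : Prop :=
  forall W (f g : Hom V W), f ∘ p = g ∘ p -> f = g.

(* [a |-> a *: idm V] is required to be injective too, so zero objects are not
   simple. *)
Definition simple V : Prop := bijective (fun a : k => a *: idm V).

Definition projective P : Prop :=
  forall U V (p : Hom U V) (f : Hom P V), epi p ->
    exists g : Hom P U, p ∘ g = f.

Definition has_dim (M : lmodType k) (n : nat) : Prop :=
  exists b : 'I_n -> M,
    forall v : M, exists! c : 'rV[k]_n, v = \sum_(i < n) c 0 i *: b i.

Definition dominating (A : C -> Prop) (J : Type) (W : J -> C) : Prop :=
  forall V, A V ->
    exists (n : nat) (i : 'I_n -> J)
           (s : forall a, Hom V (W (i a))) (iota : forall a, Hom (W (i a)) V),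
      idm V = \sum_(a < n) (iota a ∘ s a).

Definition completely_reduced (J : eqType) (W : J -> C) : Prop :=
  forall i j : J, has_dim (Hom (W i) (W j)) (i == j).

Definition is_biproduct (n : nat) (W : 'I_n -> C) V : Prop :=
  exists (inj : forall a, Hom (W a) V) (prj : forall a, Hom V (W a)),
    [/\ forall a, prj a ∘ inj a = idm (W a),
        forall a b, a != b -> prj a ∘ inj b = 0
      & \sum_(a < n) (inj a ∘ prj a) = idm V].

End LinearCategoryNotions.

(** * Linear ribbon categories *)

Record linearMonoidal (k : fieldType) := LinearMonoidal {
  mcat :> linearCategory k;
  tunit : mcat;
  tens : mcat -> mcat -> mcat
    where "U '⊗' V" := (tens U V);
  tensm : forall {U U' V V' : mcat},
    Hom U U' -> Hom V V' -> Hom (U ⊗ V) (U' ⊗ V')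
    where "f '⊗m' g" := (tensm f g);
  tensm_id : forall U V : mcat, idm U ⊗m idm V = idm (U ⊗ V);
  tensm_comp : forall (U U' U'' V V' V'' : mcat)
      (f' : Hom U' U'') (f : Hom U U') (g' : Hom V' V'') (g : Hom V V'),
    (f' ∘ f) ⊗m (g' ∘ g) = (f' ⊗m g') ∘ (f ⊗m g);
  tensm_linl : forall (U U' V V' : mcat) (a : k)
      (f f' : Hom U U') (g : Hom V V'),
    (a *: f + f') ⊗m g = a *: (f ⊗m g) + (f' ⊗m g);
  tensm_linr : forall (U U' V V' : mcat) (a : k)
      (f : Hom U U') (g g' : Hom V V'),
    f ⊗m (a *: g + g') = a *: (f ⊗m g) + (f ⊗m g');

  assoc : forall U V W : mcat, Hom ((U ⊗ V) ⊗ W) (U ⊗ (V ⊗ W));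
  assocI : forall U V W : mcat, Hom (U ⊗ (V ⊗ W)) ((U ⊗ V) ⊗ W);
  assocK : forall U V W, assocI U V W ∘ assoc U V W = idm _;
  assocIK : forall U V W, assoc U V W ∘ assocI U V W = idm _;
  assoc_nat : forall (U U' V V' W W' : mcat)
      (f : Hom U U') (g : Hom V V') (h : Hom W W'),
    assoc U' V' W' ∘ ((f ⊗m g) ⊗m h) = (f ⊗m (g ⊗m h)) ∘ assoc U V W;

  lunit : forall V : mcat, Hom (tunit ⊗ V) V;
  lunitI : forall V : mcat, Hom V (tunit ⊗ V);
  lunitK : forall V, lunitI V ∘ lunit V = idm _;
  lunitIK : forall V, lunit V ∘ lunitI V = idm _;
  lunit_nat : forall (V V' : mcat) (f : Hom V V'),
    lunit V' ∘ (idm tunit ⊗m f) = f ∘ lunit V;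

  runit : forall V : mcat, Hom (V ⊗ tunit) V;
  runitI : forall V : mcat, Hom V (V ⊗ tunit);
  runitK : forall V, runitI V ∘ runit V = idm _;
  runitIK : forall V, runit V ∘ runitI V = idm _;
  runit_nat : forall (V V' : mcat) (f : Hom V V'),
    runit V' ∘ (f ⊗m idm tunit) = f ∘ runit V;

  triangle : forall U V : mcat,
    (idm U ⊗m lunit V) ∘ assoc U tunit V = runit U ⊗m idm V;
  pentagon : forall U V W Y : mcat,
    assoc U V (W ⊗ Y) ∘ assoc (U ⊗ V) W Y
    = (idm U ⊗m assoc V W Y) ∘ assoc U (V ⊗ W) Y ∘ (assoc U V W ⊗m idm Y);

  unit_simple : simple tunit
}.

Arguments tunit {k l} : rename.
Arguments assoc {k l} U V W : rename.
Arguments assocI {k l} U V W : rename.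
Arguments lunit {k l} V : rename.
Arguments lunitI {k l} V : rename.
Arguments runit {k l} V : rename.
Arguments runitI {k l} V : rename.
Notation "U '⊗' V" := (tens U V) : cat_scope.
Notation "f '⊗m' g" := (tensm f g) : cat_scope.

(* [ev] and [coev] are the left duality (the arrows pointing right); the
   right duality is derived from it, the braiding and the twist below. *)
Record linearRibbon (k : fieldType) := LinearRibbon {
  rcat :> linearMonoidal k;

  braid : forall U V : rcat, Hom (U ⊗ V) (V ⊗ U);
  braidI : forall U V : rcat, Hom (V ⊗ U) (U ⊗ V);
  braidK : forall U V, braidI U V ∘ braid U V = idm _;
  braidIK : forall U V, braid U V ∘ braidI U V = idm _;
  braid_nat : forall (U U' V V' : rcat) (f : Hom U U') (g : Hom V V'),
    braid U' V' ∘ (f ⊗m g) = (g ⊗m f) ∘ braid U V;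
  hexagon1 : forall U V W : rcat,
    assoc V W U ∘ braid U (V ⊗ W) ∘ assoc U V W
    = (idm V ⊗m braid U W) ∘ assoc V U W ∘ (braid U V ⊗m idm W);
  hexagon2 : forall U V W : rcat,
    assocI W U V ∘ braid (U ⊗ V) W ∘ assocI U V W
    = (braid U W ⊗m idm V) ∘ assocI U W V ∘ (idm U ⊗m braid V W);

  twist : forall V : rcat, Endo V;
  twistI : forall V : rcat, Endo V;
  twistK : forall V, twistI V ∘ twist V = idm V;
  twistIK : forall V, twist V ∘ twistI V = idm V;
  twist_nat : forall (V V' : rcat) (f : Hom V V'),
    twist V' ∘ f = f ∘ twist V;
  twist_tens : forall U V : rcat,
    twist (U ⊗ V) = braid V U ∘ braid U V ∘ (twist U ⊗m twist V);

  dual : rcat -> rcat;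
  ev : forall V : rcat, Hom (dual V ⊗ V) tunit;
  coev : forall V : rcat, Hom tunit (V ⊗ dual V);
  zigzag : forall V : rcat,
    runit V ∘ (idm V ⊗m ev V) ∘ assoc V (dual V) V
      ∘ (coev V ⊗m idm V) ∘ lunitI V = idm V;
  zigzag_dual : forall V : rcat,
    lunit (dual V) ∘ (ev V ⊗m idm (dual V)) ∘ assocI (dual V) V (dual V)
      ∘ (idm (dual V) ⊗m coev V) ∘ runitI (dual V) = idm (dual V);
  twist_dual : forall V : rcat,
    (twist V ⊗m idm (dual V)) ∘ coev V = (idm V ⊗m twist (dual V)) ∘ coev V
}.

Arguments braid {k l} U V : rename.
Arguments twist {k l} V : rename.
Arguments twistI {k l} V : rename.
Arguments dual {k l} V : rename.
Arguments ev {k l} V : rename.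
Arguments coev {k l} V : rename.

Section RibbonNotions.
Context {k : fieldType} {C : linearRibbon k}.
Implicit Types U V W : C.

Definition ev_right V : Hom (V ⊗ dual V) tunit :=
  ev V ∘ braid V (dual V) ∘ (twist V ⊗m idm (dual V)).

Definition coev_right V : Hom tunit (dual V ⊗ V) :=
  (idm (dual V) ⊗m twist V) ∘ braid V (dual V) ∘ coev V.

Definition regular V : Prop := epi (ev V).

Definition qdim V : Endo (tunit : C) := ev_right V ∘ coev V.

Definition ptr V U (f : Endo (V ⊗ U)) : Endo V :=
  runit V ∘ (idm V ⊗m ev_right U) ∘ assoc V U (dual U)
    ∘ (f ⊗m idm (dual U))
    ∘ assocI V U (dual U) ∘ (idm V ⊗m coev U) ∘ runitI V.

Definition Phi U V : Endo V := ptr (braid U V ∘ braid V U).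

(* The values of [t] at objects outside of the ideal [I] are irrelevant. *)
Record is_mtrace (I : C -> Prop) (t : forall V : C, Endo V -> k) : Prop := {
  mtrace_linear : forall V, I V -> forall (a : k) (f g : Endo V),
    t V (a *: f + g) = a * t V f + t V g;
  mtrace_cyclic : forall U V, I U -> I V -> forall (f : Hom U V) (g : Hom V U),
    t V (f ∘ g) = t U (g ∘ f);
  mtrace_ptr : forall U V, I U -> forall f : Endo (U ⊗ V),
    t (U ⊗ V) f = t U (ptr f)
}.

Definition mtrace_nonzero (I : C -> Prop) (t : forall V : C, Endo V -> k) :=
  exists2 V, I V & exists f : Endo V, t V f != 0.

Record free_realisation (Z : zmodType) (sigma : Z -> C) : Prop := {
  sigma0 : sigma 0 = tunit;
  sigmaD : forall j l, sigma j ⊗ sigma l = sigma (j + l);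
  sigma_qdim : forall l,
    qdim (sigma l) = idm tunit \/ qdim (sigma l) = - idm tunit;
  sigma_twist : forall l, twist (sigma l) = idm (sigma l);
  sigma_free : forall V, simple V ->
    forall l, iso_obj (V ⊗ sigma l) V <-> l = 0
}.

(* [deg g V] means that V is an object of the full subcategory C_g.  The
   equivalence of C with the direct sum of the C_g is spelled out by
   [grading_dec], [grading_sum] and [grading_hom]: an object of the direct sum
   is a finite family of objects of the C_g for distinct g, that is, the
   biproduct of its members, and morphisms between such families are diagonal. *)
Record is_grading (G : zmodType) (deg : G -> C -> Prop) : Prop := {
  grading_dec : forall V, exists (n : nat) (g : 'I_n -> G) (W : 'I_n -> C),
    [/\ injective g, forall a, deg (g a) (W a) & is_biproduct W V];
  grading_sum : forall (n : nat) (g : 'I_n -> G) (W : 'I_n -> C),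
    injective g -> (forall a, deg (g a) (W a)) -> exists V, is_biproduct W V;
  grading_hom : forall g g' V V', deg g V -> deg g' V' ->
    (exists f : Hom V V', f <> 0) -> g = g';
  grading_unit : deg 0 tunit;
  grading_dual : forall g V, deg g V -> deg (- g) (dual V);
  grading_tens : forall g g' V V',
    deg g V -> deg g' V' -> deg (g + g') (V ⊗ V');
  grading_nonzero : forall g, exists2 V, deg g V & idm V <> 0
}.

End RibbonNotions.

(** * Pre-modular categories *)

Definition symmetric_subset (G : zmodType) (X : G -> Prop) : Prop :=
  forall g, X g <-> X (- g).

Definition small_subset (G : zmodType) (X : G -> Prop) : Prop :=
  forall s : seq G, ~ (forall h, exists2 g, g \in s & exists2 x, X x & h = g + x).

Definition bilinear_units (k : fieldType) (G Z : zmodType) (psi : G -> Z -> k) :=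
  [/\ forall g l, psi g l != 0,
      forall g g' l, psi (g + g') l = psi g l * psi g' l
    & forall g l l', psi g (l + l') = psi g l * psi g l'].

(* The finite set Theta(g) is enumerated by 'I_(rk g), which plays the role of
   the index set I_g; [rk g] and [Theta g] are irrelevant when g is in X. *)
Record premodular (k : fieldType) (G Z : zmodType) (X : G -> Prop) :=
  Premodular {
  pcat :> linearRibbon k;
  deg : G -> pcat -> Prop;
  sigma : Z -> pcat;
  mtr : forall V : pcat, Endo V -> k;
  rk : G -> nat;
  Theta : forall g, 'I_(rk g) -> pcat;

  pm_grading : is_grading deg;
  pm_sigma : free_realisation sigma;
  pm_sigma_deg : forall l, deg 0 (sigma l);
  pm_mtrace : is_mtrace projective mtr;
  pm_mtrace_nonzero : mtrace_nonzero projective mtr;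

  pm_Theta_deg : forall g, ~ X g -> forall i : 'I_(rk g), deg g (Theta i);
  pm_Theta_regular : forall g, ~ X g -> forall i : 'I_(rk g), regular (Theta i);
  pm_Theta_simple : forall g, ~ X g -> forall i : 'I_(rk g), simple (Theta i);
  pm_Theta_dominating : forall g, ~ X g ->
    dominating (deg g) (fun il : 'I_(rk g) * Z => Theta il.1 ⊗ sigma il.2);
  pm_Theta_reduced : forall g, ~ X g ->
    completely_reduced (fun il : 'I_(rk g) * Z => Theta il.1 ⊗ sigma il.2);

  pm_compat : exists2 psi : G -> Z -> k, bilinear_units psi &
    forall g l V, deg g V ->
      braid (sigma l) V ∘ braid V (sigma l) = psi g l *: idm (V ⊗ sigma l)
}.

Section PremodularNotions.
Context {k : fieldType} {G Z : zmodType} {X : G -> Prop}.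
Variable C : premodular k Z X.

Definition mdim (V : C) : k := mtr (idm V).

Definition Smx (g1 g2 : G) : 'M[k]_(rk C g1, rk C g2) :=
  \matrix_(i, j) mtr (Phi (Theta i) (Theta j)).

Definition is_Delta_minus (D : k) : Prop :=
  forall g, ~ X g ->
  forall t : 'I_(rk C g) -> k, (forall i, twist (Theta i) = t i *: idm (Theta i)) ->
  forall V : C, deg g V ->
    twistI V ∘ (\sum_i (mdim (Theta i) * (t i)^-1) *: Phi (Theta i) V)
    = D *: idm V.

Definition is_Delta_plus (D : k) : Prop :=
  forall g, ~ X g ->
  forall t : 'I_(rk C g) -> k, (forall i, twist (Theta i) = t i *: idm (Theta i)) ->
  forall V : C, deg g V ->
    twist V ∘ (\sum_i (mdim (Theta i) * t i) *: Phi (dual (Theta i)) V)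
    = D *: idm V.

End PremodularNotions.

(* Phrased for rectangular matrices because the index sets of Smx (- g) g are
   not a priori of the same size. *)
Definition invertible_mx (k : fieldType) (m n : nat) (A : 'M[k]_(m, n)) : Prop :=
  exists B : 'M[k]_(n, m), A *m B = 1%:M /\ B *m A = 1%:M.

(* Main.v *)
(* The relation defining Delta_-, evaluated on the V_j of degree g under the
   modified trace, says that Delta_- = 0 forces the row (d(V_i) / t_i)_i to lie
   in the left kernel of S_g, where no entry of it is 0: the column j of S_g is a
   multiple of d(V_j), so d(V_j) <> 0 for all j.

   For Delta_+, the relation involves Phi_{V_i^*, V_j}, whose modified trace is
   that of the double braiding of V_i^* and V_j, by the partial trace property.
   The dual V_i^* is isomorphic to V_{pi(i)} tensor sigma(k_i), with pi(i) in
   I_{-g} and pi injective.  Cyclicity of the trace makes the trace of the double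
   braiding symmetric and invariant under isomorphisms, and shows that tensoring
   with sigma(k) multiplies it by a unit (+-psi).  Hence Delta_+ = 0 gives a row
   in the left kernel of S_{-g,g} with entries d(V_i) t_i times a unit at pi(i).

   The m-trace only behaves on projective objects, so one first shows that the
   V_i are projective, by splitting off isotypic parts. *)

Require Import Defs.
From mathcomp Require Import all_boot all_order all_algebra.
Local Open Scope ring_scope.

Set Implicit Arguments.
Unset Strict Implicit.
Unset Printing Implicit Defensive.

Import Defs GRing.Theory.
Local Open Scope cat_scope.

(** * Linear categories: simple objects, isotypic parts, projectivity *)

Section LinearCategory.
Context {k : fieldType} {C : linearCategory k}.
Implicit Types U V W P : C.

Lemma compDl U V W (g g' : Hom V W) (f : Hom U V) :
  (g + g') ∘ f = g ∘ f + g' ∘ f.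
Proof. by have := comp_linl 1 g g' f; rewrite !scale1r. Qed.

Lemma compDr U V W (g : Hom V W) (f f' : Hom U V) :
  g ∘ (f + f') = g ∘ f + g ∘ f'.
Proof. by have := comp_linr 1 g f f'; rewrite !scale1r. Qed.

Lemma comp0l U V W (f : Hom U V) : (0 : Hom V W) ∘ f = 0.
Proof. by apply: (addrI (0 ∘ f)); rewrite -compDl !addr0. Qed.

Lemma comp0r U V W (g : Hom V W) : g ∘ (0 : Hom U V) = 0.
Proof. by apply: (addrI (g ∘ 0)); rewrite -compDr !addr0. Qed.

Lemma compZl U V W (a : k) (g : Hom V W) (f : Hom U V) :
  (a *: g) ∘ f = a *: (g ∘ f).
Proof. by have := comp_linl a g 0 f; rewrite comp0l !addr0. Qed.

Lemma compZr U V W (a : k) (g : Hom V W) (f : Hom U V) :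
  g ∘ (a *: f) = a *: (g ∘ f).
Proof. by have := comp_linr a g f 0; rewrite comp0r !addr0. Qed.

Lemma comp_suml U V W n (g : 'I_n -> Hom V W) (f : Hom U V) :
  (\sum_i g i) ∘ f = \sum_i (g i ∘ f).
Proof.
by apply: (big_morph (fun g : Hom V W => g ∘ f)) => [? ?|];
  rewrite ?compDl ?comp0l.
Qed.

Lemma comp_sumr U V W n (g : Hom V W) (f : 'I_n -> Hom U V) :
  g ∘ (\sum_i f i) = \sum_i (g ∘ f i).
Proof.
by apply: (big_morph (fun f : Hom U V => g ∘ f)) => [? ?|];
  rewrite ?compDr ?comp0r.
Qed.

(** Lets an equation between composites rewrite inside right-nested compositions. *)
Lemma comp2E U V W (g : Hom V W) (f : Hom U V) h :
  g ∘ f = h -> forall T (x : Hom T U), g ∘ (f ∘ x) = h ∘ x.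
Proof. by move=> <- T x; rewrite comp_assoc. Qed.

Lemma iso_refl U : iso_obj U U.
Proof. by exists (idm U), (idm U); rewrite comp_idl. Qed.

Lemma iso_eq U V : U = V -> iso_obj U V.
Proof. by move=> ->; apply: iso_refl. Qed.

Lemma iso_sym U V : iso_obj U V -> iso_obj V U.
Proof. by case=> f [g [gf fg]]; exists g, f. Qed.

Lemma iso_trans V U W : iso_obj U V -> iso_obj V W -> iso_obj U W.
Proof.
move=> [f [g [gf fg]]] [f' [g' [gf' fg']]]; exists (f' ∘ f), (g ∘ g'); split.
  by rewrite -comp_assoc (comp_assoc g' f' f) gf' comp_idl.
by rewrite -comp_assoc (comp_assoc f g g') fg comp_idl.
Qed.

Lemma iso_hom_eq0 U U' V V' : iso_obj U U' -> iso_obj V V' ->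
  (forall f : Hom U V, f = 0) -> forall f : Hom U' V', f = 0.
Proof.
move=> [f [g [gf fg]]] [f' [g' [gf' fg']]] UV0 h.
rewrite -[h]comp_idr -fg -[h]comp_idl -fg'.
rewrite -(comp_assoc f' g' h) -(comp_assoc f' (g' ∘ h) _).
by rewrite (comp_assoc (g' ∘ h) f g) (UV0 (g' ∘ h ∘ f)) comp0l comp0r.
Qed.

Lemma simple_scalar V (f : Endo V) : simple V -> exists a, f = a *: idm V.
Proof. by case=> e _ eK; exists (e f). Qed.

Lemma simple_id_neq0 V : simple V -> idm V <> 0.
Proof.
move=> sV V0; have /eqP := oner_neq0 k; apply.
by apply: (bij_inj sV); rewrite V0 !scaler0.
Qed.

(** Both composites are scalars, [c] and [d]. They agree because [i ∘ s ∘ i] equals both [d *: i]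
    and [c *: i] with [i] nonzero, so [c^-1 *: i] inverts [s]. *)
Lemma simple_iso U W (s : Hom U W) (i : Hom W U) :
  simple U -> simple W -> i ∘ s <> 0 -> iso_obj U W.
Proof.
move=> sU sW is0.
have [c isE] := simple_scalar (i ∘ s) sU.
have [d siE] := simple_scalar (s ∘ i) sW.
have c0 : c != 0 by apply/eqP => c0; apply: is0; rewrite isE c0 scale0r.
have dc : d = c.
  have: (d - c) *: i = 0.
    rewrite scalerBl -{1}[i]comp_idr -compZr -siE comp_assoc isE compZl comp_idl.
    exact: subrr.
  move/eqP; rewrite scaler_eq0 subr_eq0 => /orP [/eqP //|/eqP i0].
  by case: is0; rewrite i0 comp0l.
exists s, (c^-1 *: i); split.
  by rewrite compZl isE scalerA mulVf // scale1r.
by rewrite compZr siE dc scalerA mulVf // scale1r.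
Qed.

Lemma has_dim0 (M : lmodType k) : has_dim M 0 -> forall v : M, v = 0.
Proof. by case=> b bP v; have [c [-> _]] := bP v; rewrite big_ord0. Qed.

Lemma simple_spanned W (u : Endo W) :
  idm W <> 0 -> (forall f : Endo W, exists c, f = c *: u) -> simple W.
Proof.
move=> W0 uP; have [c idE] := uP (idm W).
have c0 : c != 0 by apply/eqP => c0; apply: W0; rewrite idE c0 scale0r.
(* Bijectivity asks for an inverse function: the coefficient of [f] is selected by the choice
   operator of [k]. *)
have ex (f : Endo W) : {a | f == a *: idm W}.
  apply: sigW; have [d ->] := uP f.
  by exists (d / c); rewrite idE scalerA divfK.
exists (fun f => sval (ex f)) => [a|f]; last by case: ex => a /= /eqP ->.
case: ex => a' /= /eqP /eqP; rewrite -subr_eq0 -scalerBl scaler_eq0.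
by case/orP=> [|/eqP //]; rewrite subr_eq0 => /eqP.
Qed.

Lemma has_dim1_simple W : has_dim (Hom W W) 1 -> simple W.
Proof.
case=> b bP; pose b0 := b ord0.
have bE (c : 'rV[k]_1) : \sum_(i < 1) c 0 i *: b i = c 0 0 *: b0.
  by rewrite big_ord_recl big_ord0 addr0.
apply: (@simple_spanned _ b0) => [W0|f]; last first.
  by have [c [-> _]] := bP f; exists (c 0 0); rewrite bE.
(* With [b0 = 0], the coordinates 0 and 1 both represent the zero vector, against uniqueness. *)
have b00 : b0 = 0 by rewrite -[b0]comp_idl W0 comp0l.
have [c [_ cU]] := bP 0.
have c0 : c = 0 by apply: cU; rewrite bE b00 scaler0.
have c1 : c = const_mx 1 by apply: cU; rewrite bE b00 scaler0.
by move: c0; rewrite c1 => /matrixP/(_ 0 0); rewrite !mxE; apply/eqP/oner_neq0.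
Qed.

Lemma projective_retract U V (s : Hom U V) (r : Hom V U) :
  r ∘ s = idm U -> projective V -> projective U.
Proof.
move=> rs pV A B p f ep; have [g gE] := pV A B p (f ∘ r) ep.
by exists (g ∘ s); rewrite comp_assoc gE -comp_assoc rs comp_idr.
Qed.

(* For simple [P], this says that the [P]-isotypic part of [V] splits off as a
   finite sum of copies of [P]. *)
Definition isotypic_split P V : Prop :=
  exists (n : nat) (iota : 'I_n -> Hom P V) (s : 'I_n -> Hom V P),
    (forall f : Hom P V, f = \sum_a (iota a ∘ s a ∘ f)) /\
    (forall f : Hom V P, f = \sum_a (f ∘ (iota a ∘ s a))).

(* [p] induces a matrix [Q] between the multiplicity spaces of [P]; a row vector
   killed by [Q] is a morphism [V -> P] killed by the epimorphism [p]. *)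
Lemma split_projective P :
  simple P -> (forall V, isotypic_split P V) -> projective P.
Proof.
move=> sP spl U V p f ep; have [e eK Ke] := sP.
have [m [ka [r [_ rP]]]] := spl U; have [n [io [s [iP _]]]] := spl V.
have e0 : e 0 = 0 by rewrite -(scale0r (idm P)) eK.
pose Q := \matrix_(b < m, a < n) e (s a ∘ p ∘ ka b).
pose F := \row_(a < n) e (s a ∘ f).
have QE b a : Q b a *: idm P = s a ∘ p ∘ ka b by rewrite mxE Ke.
have FE a : F 0 a *: idm P = s a ∘ f by rewrite mxE Ke.
(* If [F = c *m Q], the combination of the [ka b] with coefficients [c] lifts [f]: both sides agree
   after every [s a]. *)
suff /submxP [c FQ] : (F <= Q)%MS.
  exists (\sum_b c 0 b *: ka b).
  rewrite comp_sumr [RHS]iP [LHS]iP; apply: eq_bigr => a _.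
  rewrite -!comp_assoc; congr (_ ∘ _); rewrite comp_sumr.
  rewrite -FE FQ mxE scaler_suml; apply: eq_bigr => b _.
  by rewrite !compZr -scalerA QE comp_assoc.
rewrite submxE; apply/eqP/rowP => j; rewrite mxE [RHS]mxE.
(* The column [y] of the cokernel satisfies [Q *m y = 0], so [phi ∘ p] kills every [ka b], hence is
   zero. *)
pose y a := cokermx Q a j; pose phi := \sum_a y a *: s a.
have phip b : phi ∘ p ∘ ka b = 0.
  rewrite !comp_suml.
  transitivity ((\sum_a Q b a * y a) *: idm P).
    rewrite scaler_suml; apply: eq_bigr => a _.
    by rewrite !compZl mulrC -scalerA QE.
  have /matrixP/(_ b j) := mulmx_coker Q.
  by rewrite mxE [RHS]mxE => ->; rewrite scale0r.
have phi0 : phi = 0.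
  apply: ep; rewrite comp0l [LHS]rP big1 // => b _.
  by rewrite comp_assoc phip comp0l.
transitivity (e (phi ∘ f)); last by rewrite phi0 comp0l.
rewrite -[LHS]eK; congr e; rewrite comp_suml scaler_suml.
by apply: eq_bigr => a _; rewrite compZl mulrC -scalerA FE.
Qed.

End LinearCategory.

(** * Monoidal coherence derived from the triangle and the pentagon *)

Section Monoidal.
Context {k : fieldType} {C : linearMonoidal k}.
Implicit Types U V W P Y : C.

Lemma tensmDl U U' V V' (f f' : Hom U U') (g : Hom V V') :
  (f + f') ⊗m g = f ⊗m g + f' ⊗m g.
Proof. by have := tensm_linl 1 f f' g; rewrite !scale1r. Qed.

Lemma tensm0l U U' V V' (g : Hom V V') : (0 : Hom U U') ⊗m g = 0.
Proof. by apply: (addrI (0 ⊗m g)); rewrite -tensmDl !addr0. Qed.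

Lemma tensmZl U U' V V' (a : k) (f : Hom U U') (g : Hom V V') :
  (a *: f) ⊗m g = a *: (f ⊗m g).
Proof. by have := tensm_linl a f 0 g; rewrite tensm0l !addr0. Qed.

Lemma tensmDr U U' V V' (f : Hom U U') (g g' : Hom V V') :
  f ⊗m (g + g') = f ⊗m g + f ⊗m g'.
Proof. by have := tensm_linr 1 f g g'; rewrite !scale1r. Qed.

Lemma tensm0r U U' V V' (f : Hom U U') : f ⊗m (0 : Hom V V') = 0.
Proof. by apply: (addrI (f ⊗m 0)); rewrite -tensmDr !addr0. Qed.

Lemma tensmZr U U' V V' (a : k) (f : Hom U U') (g : Hom V V') :
  f ⊗m (a *: g) = a *: (f ⊗m g).
Proof. by have := tensm_linr a f g 0; rewrite tensm0r !addr0. Qed.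

Lemma tensm_compl U U' U'' V (f' : Hom U' U'') (f : Hom U U') :
  (f' ∘ f) ⊗m idm V = (f' ⊗m idm V) ∘ (f ⊗m idm V).
Proof. by rewrite -tensm_comp comp_idl. Qed.

Lemma tensm_compr U V V' V'' (g' : Hom V' V'') (g : Hom V V') :
  idm U ⊗m (g' ∘ g) = (idm U ⊗m g') ∘ (idm U ⊗m g).
Proof. by rewrite -tensm_comp comp_idl. Qed.

Lemma tensm_swap U U' V V' (f : Hom U U') (g : Hom V V') :
  (f ⊗m idm V') ∘ (idm U ⊗m g) = (idm U' ⊗m g) ∘ (f ⊗m idm V).
Proof. by rewrite -!tensm_comp !comp_idl !comp_idr. Qed.

Lemma iso_tens U U' V V' :
  iso_obj U U' -> iso_obj V V' -> iso_obj (U ⊗ V) (U' ⊗ V').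
Proof.
move=> [f [g [gf fg]]] [f' [g' [gf' fg']]]; exists (f ⊗m f'), (g ⊗m g').
by rewrite -!tensm_comp gf fg gf' fg' !tensm_id.
Qed.

Lemma iso_runit V : iso_obj (V ⊗ tunit) V.
Proof. by exists (runit V), (runitI V); rewrite runitK runitIK. Qed.

Lemma iso_lunit V : iso_obj (tunit ⊗ V) V.
Proof. by exists (lunit V), (lunitI V); rewrite lunitK lunitIK. Qed.

Lemma iso_assoc U V W : iso_obj ((U ⊗ V) ⊗ W) (U ⊗ (V ⊗ W)).
Proof. by exists (assoc U V W), (assocI U V W); rewrite assocK assocIK. Qed.

Lemma assocI_nat U U' V V' W W' (f : Hom U U') (g : Hom V V') (h : Hom W W') :
  assocI U' V' W' ∘ (f ⊗m (g ⊗m h)) = ((f ⊗m g) ⊗m h) ∘ assocI U V W.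
Proof.
rewrite -[LHS]comp_idr -(assocIK U V W) comp_assoc; congr (_ ∘ _).
by rewrite -comp_assoc -assoc_nat comp_assoc assocK comp_idl.
Qed.

Lemma runitI_nat V V' (f : Hom V V') :
  runitI V' ∘ f = (f ⊗m idm tunit) ∘ runitI V.
Proof.
rewrite -[LHS]comp_idr -(runitIK V) comp_assoc; congr (_ ∘ _).
by rewrite -comp_assoc -runit_nat comp_assoc runitK comp_idl.
Qed.

Lemma tensm_unitr_inj V V' (f g : Hom V V') :
  f ⊗m idm tunit = g ⊗m idm (tunit : C) -> f = g.
Proof.
move=> fg; rewrite -[f]comp_idr -[g]comp_idr -(runitIK V) !comp_assoc.
by rewrite -!runit_nat fg.
Qed.

Lemma tensm_unitl_inj V V' (f g : Hom V V') :
  idm tunit ⊗m f = idm (tunit : C) ⊗m g -> f = g.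
Proof.
move=> fg; rewrite -[f]comp_idr -[g]comp_idr -(lunitIK V) !comp_assoc.
by rewrite -!lunit_nat fg.
Qed.

(** Tensoring with the unit is faithful; after it, every [runit] can be traded for a [lunit] by the
    triangle, and the pentagon applies. *)
Lemma runit_tens U V : runit (U ⊗ V) = (idm U ⊗m runit V) ∘ assoc U V tunit.
Proof.
apply: tensm_unitr_inj; rewrite tensm_compl -triangle.
rewrite -[LHS]comp_idl -[RHS]comp_idl -(assocK U V tunit) -!comp_assoc.
congr (_ ∘ _); rewrite (comp_assoc (assoc _ _ _) (_ ⊗m _)) -tensm_id assoc_nat.
rewrite -comp_assoc pentagon !comp_assoc -tensm_comp comp_idl triangle.
by rewrite -assoc_nat.
Qed.

Lemma lunit_tens U V : lunit (U ⊗ V) ∘ assoc tunit U V = lunit U ⊗m idm V.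
Proof.
suff H Y : idm Y ⊗m (lunit (U ⊗ V) ∘ assoc tunit U V)
           = idm Y ⊗m (lunit U ⊗m idm V) by apply: tensm_unitl_inj.
(* The associators are invertible, so both sides may be compared along the long path of the
   pentagon. *)
have cancel (W : C) (f g : Hom (Y ⊗ ((tunit ⊗ U) ⊗ V)) W) :
    f ∘ assoc Y (tunit ⊗ U) V ∘ (assoc Y tunit U ⊗m idm V)
    = g ∘ assoc Y (tunit ⊗ U) V ∘ (assoc Y tunit U ⊗m idm V) -> f = g.
  move=> fg; have := congr1 (fun h => h ∘ (assocI Y tunit U ⊗m idm V)
                               ∘ assocI Y (tunit ⊗ U) V) fg.
  rewrite -!comp_assoc !(comp_assoc (_ ⊗m _) (_ ⊗m _)) -!tensm_comp !assocIK.
  by rewrite comp_idl tensm_id !comp_idl !assocIK !comp_idr.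
apply: cancel.
rewrite -[in RHS]assoc_nat -[RHS]comp_assoc -[in RHS]tensm_comp comp_idl.
rewrite triangle tensm_compr -!comp_assoc.
rewrite (comp_assoc (idm Y ⊗m assoc _ _ _)) -pentagon.
by rewrite comp_assoc triangle -tensm_id -assoc_nat.
Qed.

Lemma assoc_runitI U V : assoc U V tunit ∘ runitI (U ⊗ V) = idm U ⊗m runitI V.
Proof.
rewrite -[LHS]comp_idl -tensm_id -(runitK V) tensm_compr -!comp_assoc.
rewrite (comp2E (esym (runit_tens U V))).
by rewrite runitIK comp_idr.
Qed.

Lemma runit_assocI U V : runit (U ⊗ V) ∘ assocI U V tunit = idm U ⊗m runit V.
Proof. by rewrite runit_tens -comp_assoc assocIK comp_idr. Qed.

Lemma runit_tensl U V :
  (runit U ⊗m idm V) ∘ assocI U tunit V = idm U ⊗m lunit V.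
Proof. by rewrite -triangle -comp_assoc assocIK comp_idr. Qed.

Lemma runitI_tensl U V :
  assoc U tunit V ∘ (runitI U ⊗m idm V) = idm U ⊗m lunitI V.
Proof.
rewrite -[LHS]comp_idl -tensm_id -(lunitK V) tensm_compr -!comp_assoc.
by rewrite (comp2E (triangle U V)) -tensm_compl runitIK tensm_id comp_idr.
Qed.

Lemma lunitI_tensr U V :
  assocI U tunit V ∘ (idm U ⊗m lunitI V) = runitI U ⊗m idm V.
Proof. by rewrite -runitI_tensl comp_assoc assocK comp_idl. Qed.

Lemma pentagonI_outl U V W Y :
  assoc (U ⊗ V) W Y ∘ (assocI U V W ⊗m idm Y)
  = assocI U V (W ⊗ Y) ∘ ((idm U ⊗m assoc V W Y) ∘ assoc U (V ⊗ W) Y).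
Proof.
rewrite -[LHS]comp_idl -(assocK U V (W ⊗ Y)) -!comp_assoc; congr (_ ∘ _).
rewrite (comp2E (pentagon U V W Y)) -!comp_assoc -tensm_compl assocIK tensm_id.
by rewrite comp_idr.
Qed.

Lemma pentagonI_outr U V W Y :
  assocI U V (W ⊗ Y) ∘ (idm U ⊗m assoc V W Y)
  = assoc (U ⊗ V) W Y ∘ ((assocI U V W ⊗m idm Y) ∘ assocI U (V ⊗ W) Y).
Proof.
rewrite (comp2E (pentagonI_outl U V W Y)) -!comp_assoc assocIK.
by rewrite comp_idr.
Qed.

Lemma pentagonI_mid U V W Y :
  (assoc U V W ⊗m idm Y) ∘ assocI (U ⊗ V) W Y
  = assocI U (V ⊗ W) Y ∘ ((idm U ⊗m assocI V W Y) ∘ assoc U V (W ⊗ Y)).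
Proof.
rewrite -[in RHS](comp_idr (assoc U V _)) -(assocIK (U ⊗ V) W Y).
rewrite (comp2E (pentagon U V W Y)) -!comp_assoc.
rewrite (comp2E (esym (tensm_compr _ _ _))) assocK tensm_id comp_idl.
by rewrite (comp2E (assocK _ _ _)) comp_idl.
Qed.

End Monoidal.

(** * Duality adjunctions, projective ideal, partial trace and double braiding *)

Section Ribbon.
Context {k : fieldType} {C : linearRibbon k}.
Implicit Types U V W P Q Y : C.

(** Transposition for the adjunction between tensoring on the right with [V] and with [dual V]. *)
Definition curry P V W (f : Hom (P ⊗ V) W) : Hom P (W ⊗ dual V) :=
  (f ⊗m idm (dual V)) ∘ assocI P V (dual V) ∘ (idm P ⊗m coev V) ∘ runitI P.

Definition uncurry P V W (g : Hom P (W ⊗ dual V)) : Hom (P ⊗ V) W :=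
  runit W ∘ (idm W ⊗m ev V) ∘ assoc W (dual V) V ∘ (g ⊗m idm V).

(** Transposition for the adjunction between tensoring on the left with [dual V] and with [V]. *)
Definition cocurry V Q W (h : Hom (dual V ⊗ Q) W) : Hom Q (V ⊗ W) :=
  (idm V ⊗m h) ∘ assoc V (dual V) Q ∘ (coev V ⊗m idm Q) ∘ lunitI Q.

Definition councurry V Q W (g : Hom Q (V ⊗ W)) : Hom (dual V ⊗ Q) W :=
  lunit W ∘ (ev V ⊗m idm W) ∘ assocI (dual V) V W ∘ (idm (dual V) ⊗m g).

(** Naturality slides [f] to the outside; what remains is [idm P] tensored with the zigzag of
    [V]. *)
Lemma curryK P V W (f : Hom (P ⊗ V) W) : uncurry (curry f) = f.
Proof.
rewrite /uncurry /curry !tensm_compl -!comp_assoc.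
rewrite (comp2E (assoc_nat f (idm _) (idm _))) -!comp_assoc tensm_id.
rewrite (comp2E (esym (tensm_swap f (ev V)))) -!comp_assoc.
rewrite (comp2E (runit_nat f)) -!comp_assoc -[RHS]comp_idr; congr (_ ∘ _).
rewrite (comp2E (pentagonI_outl _ _ _ _)) -!comp_assoc.
rewrite (comp2E (assoc_nat (idm P) (coev V) (idm V))) -!comp_assoc.
rewrite runitI_tensl -(tensm_id P V) (comp2E (esym (assocI_nat _ _ _))).
rewrite -!comp_assoc (comp2E (runit_assocI P V)).
by rewrite -!tensm_compr !comp_assoc zigzag tensm_id.
Qed.

Lemma uncurryK P V W (g : Hom P (W ⊗ dual V)) : curry (uncurry g) = g.
Proof.
rewrite /uncurry /curry !tensm_compl -!comp_assoc.
rewrite (comp2E (esym (assocI_nat g (idm _) (idm _)))) -!comp_assoc tensm_id.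
rewrite (comp2E (tensm_swap g (coev V))) -!comp_assoc.
rewrite -(runitI_nat g) !comp_assoc -[RHS]comp_idl; congr (_ ∘ _).
rewrite -!comp_assoc (comp2E (pentagonI_mid _ _ _ _)) -!comp_assoc.
rewrite -(tensm_id W) (comp2E (assoc_nat _ _ _)) -!comp_assoc assoc_runitI.
rewrite (comp2E (esym (assocI_nat _ _ _))) -!comp_assoc.
rewrite (comp2E (runit_tensl _ _)).
by rewrite -!tensm_compr !comp_assoc zigzag_dual tensm_id.
Qed.

Lemma cocurryK V Q W (h : Hom (dual V ⊗ Q) W) : councurry (cocurry h) = h.
Proof.
rewrite /councurry /cocurry !tensm_compr -!comp_assoc.
rewrite (comp2E (assocI_nat (idm _) (idm _) h)) -!comp_assoc tensm_id.
rewrite (comp2E (tensm_swap (ev V) h)) -!comp_assoc.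
rewrite (comp2E (lunit_nat h)) -!comp_assoc -[RHS]comp_idr; congr (_ ∘ _).
rewrite (comp2E (pentagonI_outr _ _ _ _)) -!comp_assoc.
rewrite (comp2E (assocI_nat _ _ _)) -!comp_assoc lunitI_tensr.
rewrite -(tensm_id _ Q) (comp2E (esym (assoc_nat _ _ _))) -!comp_assoc.
rewrite (comp2E (lunit_tens _ _)).
by rewrite -!tensm_compl !comp_assoc zigzag_dual tensm_id.
Qed.

Lemma curry_comp P P' V W (f : Hom (P ⊗ V) W) (p : Hom P' P) :
  curry (f ∘ (p ⊗m idm V)) = curry f ∘ p.
Proof.
rewrite /curry tensm_compl -!comp_assoc runitI_nat.
rewrite (comp2E (esym (tensm_swap p (coev V)))) -!comp_assoc.
rewrite -(tensm_id V (dual V)) (comp2E (assocI_nat p (idm V) (idm (dual V)))).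
by rewrite -!comp_assoc.
Qed.

Lemma comp_uncurry P V W W' (p : Hom W W') (g : Hom P (W ⊗ dual V)) :
  p ∘ uncurry g = uncurry ((p ⊗m idm (dual V)) ∘ g).
Proof.
rewrite /uncurry tensm_compl -!comp_assoc.
rewrite (comp2E (esym (runit_nat p))) -!comp_assoc.
rewrite (comp2E (tensm_swap p (ev V))) -!comp_assoc.
by rewrite -(tensm_id (dual V) V) (comp2E (esym (assoc_nat _ _ _))) -!comp_assoc.
Qed.

(** Transposition turns maps out of [U' ⊗ V] into maps out of [U'], where [p] can be cancelled. *)
Lemma epi_tensl U U' V (p : Hom U U') : epi p -> epi (p ⊗m idm V).
Proof.
move=> ep W f g fg; rewrite -[f]curryK -[g]curryK; congr uncurry.
by apply: ep; rewrite -!curry_comp fg.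
Qed.

Lemma projective_tensl P V : projective P -> projective (P ⊗ V).
Proof.
move=> pP A B p f ep.
have [g gE] := pP _ _ _ (curry f) (epi_tensl (V := dual V) ep).
by exists (uncurry g); rewrite comp_uncurry gE curryK.
Qed.

Lemma projective_tensr P V : projective P -> projective (V ⊗ P).
Proof.
move=> /(projective_tensl (V := V)); apply: projective_retract.
exact: braidK.
Qed.

Lemma iso_braid U V : iso_obj (U ⊗ V) (V ⊗ U).
Proof. by exists (braid U V), (braidI U V); rewrite braidK braidIK. Qed.

Lemma curryZ P V W a (f : Hom (P ⊗ V) W) : curry (a *: f) = a *: curry f.
Proof. by rewrite /curry tensmZl !compZl. Qed.

Lemma councurryZ V Q W a (g : Hom Q (V ⊗ W)) :
  councurry (a *: g) = a *: councurry g.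
Proof. by rewrite /councurry tensmZr !compZr. Qed.

(** Two transpositions send an endomorphism of [dual V] to a map from [V] to [V ⊗ tunit], a multiple
    of [runitI V]; [u] is what [runitI V] gives on the way back. *)
Lemma simple_dual V : simple V -> simple (dual V).
Proof.
move=> sV.
pose u : Endo (dual V) := lunit _ ∘ curry (councurry (runitI V)).
apply: (@simple_spanned _ _ _ u) => [V0|g].
  apply: (simple_id_neq0 sV).
  have coev0 : coev V = 0.
    by rewrite -[coev V]comp_idl -tensm_id V0 tensm0r comp0l.
  by rewrite -zigzag coev0 tensm0l comp0r comp0l.
pose h := uncurry (lunitI _ ∘ g).
have [c hE] := simple_scalar (runit V ∘ cocurry h) sV.
exists c.
have cE : cocurry h = c *: runitI V.
  by rewrite -[LHS]comp_idl -runitK -comp_assoc hE compZr comp_idr.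
rewrite /u -compZr -curryZ -councurryZ -cE cocurryK uncurryK.
by rewrite comp_assoc lunitIK comp_idl.
Qed.

(** Transposing [U] and [V] to the other side, with a braiding of [Y] and [dual V] in between,
    embeds the second Hom-space into the first. *)
Lemma hom_dual_eq0 U V Y :
  (forall f : Hom V (U ⊗ Y), f = 0) ->
  forall f : Hom (dual U) (dual V ⊗ Y), f = 0.
Proof.
move=> UV0; apply: iso_hom_eq0 (iso_runit _) (iso_refl _) _ => f.
suff f0 : cocurry f = 0 by rewrite -[f]cocurryK f0 /councurry tensm0r comp0r.
move: (cocurry f); apply: iso_hom_eq0 (iso_refl _) _ _.
  apply: iso_trans (iso_assoc U Y (dual V)) _.
  exact: iso_tens (iso_refl _) (iso_braid _ _).
move=> g; suff g0 : uncurry g = 0.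
  by rewrite -[g]uncurryK g0 /curry tensm0l !comp0l.
move: (uncurry g).
exact: iso_hom_eq0 (iso_sym (iso_lunit _)) (iso_refl _) UV0.
Qed.

(** The closed strand [U] is a separate loop, worth its quantum dimension. *)
Lemma ptr_tensl V U (f : Endo V) a :
  qdim U = a *: idm tunit -> ptr (f ⊗m idm U) = a *: f.
Proof.
move=> qdimE; rewrite /ptr -!comp_assoc.
rewrite (comp2E (assoc_nat f (idm U) (idm _))) -!comp_assoc tensm_id.
rewrite (comp2E (assocIK _ _ _)) comp_idl.
rewrite (comp2E (esym (tensm_swap f _))) -!comp_assoc.
rewrite (comp2E (runit_nat f)) -!comp_assoc.
rewrite (comp2E (esym (tensm_compr _ _ _))) -/(qdim U) qdimE.
by rewrite tensmZr tensm_id compZl comp_idl !compZr runitIK comp_idr.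
Qed.

(** The double braiding; [Phi U V] is by definition [ptr (monodromy V U)]. *)
Definition monodromy U V : Endo (U ⊗ V) := braid V U ∘ braid U V.

Lemma monodromy_natl U U' V (f : Hom U U') :
  monodromy U' V ∘ (f ⊗m idm V) = (f ⊗m idm V) ∘ monodromy U V.
Proof.
by rewrite /monodromy -!comp_assoc braid_nat comp_assoc braid_nat comp_assoc.
Qed.

(** By the two hexagons, [Y] passes [V], makes a full turn with [U], and passes back over [V]. *)
Lemma monodromy_tensl U V Y :
  monodromy (U ⊗ V) Y =
    assocI U V Y ∘ (idm U ⊗m braid Y V) ∘ assoc U Y V ∘ (monodromy U Y ⊗m idm V)
    ∘ assocI U Y V ∘ (idm U ⊗m braid V Y) ∘ assoc U V Y.
Proof.
have braid_l : braid (U ⊗ V) Y = assoc Y U V ∘ (braid U Y ⊗m idm V)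
    ∘ assocI U Y V ∘ (idm U ⊗m braid V Y) ∘ assoc U V Y.
  rewrite -[LHS]comp_idr -[LHS]comp_idl -(assocIK Y U V) -(assocK U V Y).
  rewrite -!comp_assoc; congr (_ ∘ _); rewrite !comp_assoc; congr (_ ∘ _).
  exact: hexagon2.
have braid_r : braid Y (U ⊗ V) = assocI U V Y ∘ (idm U ⊗m braid Y V)
    ∘ assoc U Y V ∘ (braid Y U ⊗m idm V) ∘ assocI Y U V.
  rewrite -[LHS]comp_idr -[LHS]comp_idl -(assocIK Y U V) -(assocK U V Y).
  rewrite -!comp_assoc; congr (_ ∘ _); rewrite !comp_assoc; congr (_ ∘ _).
  exact: hexagon1.
rewrite /monodromy braid_l braid_r tensm_compl -!comp_assoc.
by rewrite (comp2E (assocK _ _ _)) comp_idl.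
Qed.

(** * The m-trace of a double braiding *)

Section ModifiedTrace.
Variable t : forall V : C, Endo V -> k.
Hypothesis t_mtrace : is_mtrace projective t.

Lemma mtrD V (f g : Endo V) : projective V -> t (f + g) = t f + t g.
Proof.
by move=> pV; have := mtrace_linear t_mtrace pV 1 f g; rewrite scale1r mul1r.
Qed.

Lemma mtr0 V : projective V -> t (0 : Endo V) = 0.
Proof.
move=> pV; apply: (addrI (t (0 : Endo V))); rewrite addr0.
by rewrite -(mtrD _ _ pV) addr0.
Qed.

Lemma mtrZ V a (f : Endo V) : projective V -> t (a *: f) = a * t f.
Proof.
by move=> pV; have := mtrace_linear t_mtrace pV a f 0; rewrite mtr0 // !addr0.
Qed.

Lemma mtr_sum V n (f : 'I_n -> Endo V) :
  projective V -> t (\sum_i f i) = \sum_i t (f i).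
Proof.
move=> pV; apply: (big_morph (fun f : Endo V => t f)) => [? ?|].
  exact: mtrD.
exact: mtr0.
Qed.

(** Cyclicity exchanges the two braidings; both tensor products lie in the projective ideal because
    [U] does. *)
Lemma mtr_monodromyC U V :
  projective U -> t (monodromy U V) = t (monodromy V U).
Proof.
move=> pU; apply: (mtrace_cyclic t_mtrace).
  exact: projective_tensr.
exact: projective_tensl.
Qed.

Lemma mtr_monodromy_iso U U' V : projective V -> iso_obj U U' ->
  t (monodromy U V) = t (monodromy U' V).
Proof.
move=> pV [f [g [gf fg]]].
rewrite -[monodromy U V]comp_idr -tensm_id -gf tensm_compl comp_assoc.
rewrite (mtrace_cyclic t_mtrace); try exact: projective_tensr.
rewrite comp_assoc -monodromy_natl -comp_assoc -tensm_compl fg.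
by rewrite tensm_id comp_idr.
Qed.

Lemma mtr_monodromy_transparent V S Y a b : projective V ->
  qdim S = a *: idm tunit -> monodromy Y S = b *: idm (Y ⊗ S) ->
  t (monodromy (V ⊗ S) Y) = b * (a * t (monodromy V Y)).
Proof.
move=> pV qdimE mE.
(* [al] and [be] are the crossings of [Y] with [S] on the two sides of its full turn with [V].
   Cyclicity brings them together into the scalar [b], and the partial trace over [S] gives [a]. *)
pose al := assocI V S Y ∘ (idm V ⊗m braid Y S) ∘ assoc V Y S.
pose be := assocI V Y S ∘ (idm V ⊗m braid S Y) ∘ assoc V S Y.
have beal : be ∘ al = b *: idm _.
  rewrite /be /al -!comp_assoc (comp2E (assocIK _ _ _)) comp_idl.
  rewrite (comp2E (esym (tensm_compr _ _ _))) -/(monodromy Y S) mE tensmZr.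
  by rewrite tensm_id compZl comp_idl compZr assocK.
have -> : monodromy (V ⊗ S) Y = al ∘ ((monodromy V Y ⊗m idm S) ∘ be).
  by rewrite monodromy_tensl /al /be -!comp_assoc.
rewrite (mtrace_cyclic t_mtrace); try by do 2!apply: projective_tensl.
rewrite -comp_assoc beal compZr comp_idr mtrZ; last first.
  by do 2!apply: projective_tensl.
rewrite (mtrace_ptr t_mtrace); last exact: projective_tensl.
by rewrite (ptr_tensl _ qdimE) mtrZ //; apply: projective_tensl.
Qed.

End ModifiedTrace.

End Ribbon.

(** * Generic simple objects and the entries of the S-matrices *)

Section Premodular.
Context {k : fieldType} {G Z : zmodType} {X : G -> Prop}.
Variable C : premodular k Z X.
Variable g : G.
Hypothesis Xg : ~ X g.
Implicit Types (i j : 'I_(rk C g)) (l : Z) (V : C).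

Lemma iso_tens_sigma0 V : iso_obj (V ⊗ sigma C 0) V.
Proof. by rewrite (sigma0 (pm_sigma C)); apply: iso_runit. Qed.

Lemma Theta_sigma_hom_eq0 i j l l' : (i, l) != (j, l') ->
  forall f : Hom (Theta i ⊗ sigma C l) (Theta j ⊗ sigma C l'), f = 0.
Proof.
move=> ij; have := pm_Theta_reduced Xg (i, l) (j, l').
by rewrite (negPf ij); apply: has_dim0.
Qed.

Lemma Theta_sigma_simple i l : simple (Theta i ⊗ sigma C l).
Proof.
apply: has_dim1_simple; have := pm_Theta_reduced Xg (i, l) (i, l).
by rewrite eqxx.
Qed.

Lemma Theta_split_homogeneous i V : deg g V -> isotypic_split (Theta i) V.
Proof.
move=> dV; have [n [x [s [io idE]]]] := pm_Theta_dominating Xg dV.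
(* A summand through [Theta i ⊗ sigma 0] is rerouted through [Theta i]; any other has no maps to or
   from [Theta i] and is replaced by zero. *)
have /fin_all_exists [r rP] (a : 'I_n) :
    exists r : Hom (Theta i) V * Hom V (Theta i),
      (forall f : Hom (Theta i) V, io a ∘ s a ∘ f = r.1 ∘ r.2 ∘ f) /\
      (forall f : Hom V (Theta i), f ∘ (io a ∘ s a) = f ∘ (r.1 ∘ r.2)).
  have [xE|xN] := eqVneq (x a) (i, 0).
    have [u [v [vu _]]] :
        iso_obj (Theta (x a).1 ⊗ sigma C (x a).2) (Theta i).
      by rewrite xE; apply: iso_tens_sigma0.
    exists (io a ∘ v, u ∘ s a) => /=.
    have -> : io a ∘ v ∘ (u ∘ s a) = io a ∘ s a.
      by rewrite -comp_assoc (comp2E vu) comp_idl.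
    by [].
  exists (0, 0) => /=; split=> f.
    rewrite -comp_assoc [s a ∘ f](_ : _ = 0) ?comp0l ?comp0r //.
    move: (s a ∘ f); apply: iso_hom_eq0 (iso_tens_sigma0 _) (iso_refl _) _.
    by apply: Theta_sigma_hom_eq0; rewrite eq_sym -surjective_pairing.
  rewrite comp_assoc [f ∘ io a](_ : _ = 0) ?comp0l ?comp0r //.
  move: (f ∘ io a); apply: iso_hom_eq0 (iso_refl _) (iso_tens_sigma0 _) _.
  by apply: Theta_sigma_hom_eq0; rewrite -surjective_pairing.
exists n, (fun a => (r a).1), (fun a => (r a).2); split=> f.
  rewrite -[LHS]comp_idl idE comp_suml; apply: eq_bigr => a _.
  exact: (rP a).1.
rewrite -[LHS]comp_idr idE comp_sumr; apply: eq_bigr => a _.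
exact: (rP a).2.
Qed.

Lemma hom_deg_eq0 h h' V V' : deg h V -> deg h' V' -> h != h' ->
  forall f : Hom V V', f = 0.
Proof.
move=> dV dV' hh' f; apply/eqP; apply: contraNT hh' => /eqP f0.
by apply/eqP; apply: (grading_hom (pm_grading C) dV dV'); exists f.
Qed.

Lemma Theta_split i V : isotypic_split (Theta i) V.
Proof.
have [n [h [W [h_inj dW [inj [prj [_ _ idE]]]]]]] :=
  grading_dec (pm_grading C) V.
have dT := pm_Theta_deg Xg i.
(* At most one homogeneous component has degree [g], the degrees being distinct; without one the
   empty family works. *)
have [a0 /eqP ha0|hN] := pickP (fun a => h a == g); last first.
  exists 0%N, (fun=> 0), (fun=> 0); split=> f.
    rewrite -[LHS]comp_idl -idE comp_suml big_ord0 big1 // => a _.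
    rewrite -comp_assoc (_ : prj a ∘ f = 0) ?comp0r //.
    by apply: hom_deg_eq0 dT (dW a) _ _; rewrite eq_sym hN.
  rewrite -[LHS]comp_idr -idE comp_sumr big_ord0 big1 // => a _.
  rewrite comp_assoc (_ : f ∘ inj a = 0) ?comp0l //.
  by apply: hom_deg_eq0 (dW a) dT _ _; rewrite hN.
have hN a : a != a0 -> h a != g by rewrite -ha0 (inj_eq h_inj).
have dW0 : deg g (W a0) by rewrite -ha0.
have [m [io [s [ioP sP]]]] := Theta_split_homogeneous i dW0.
exists m, (fun b => inj a0 ∘ io b), (fun b => s b ∘ prj a0); split=> f.
  rewrite -[LHS]comp_idl -idE comp_suml (bigD1 a0) //= big1 ?addr0 => [|a aN].
    rewrite -comp_assoc [prj a0 ∘ f]ioP comp_sumr; apply: eq_bigr => b _.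
    by rewrite -!comp_assoc.
  rewrite -comp_assoc (_ : prj a ∘ f = 0) ?comp0r //.
  by apply: hom_deg_eq0 dT (dW a) _ _; rewrite eq_sym hN.
rewrite -[LHS]comp_idr -idE comp_sumr (bigD1 a0) //= big1 ?addr0 => [|a aN].
  rewrite comp_assoc [f ∘ inj a0]sP comp_suml; apply: eq_bigr => b _.
  by rewrite -!comp_assoc.
rewrite comp_assoc (_ : f ∘ inj a = 0) ?comp0l //.
by apply: hom_deg_eq0 (dW a) dT _ _; rewrite hN.
Qed.

Lemma Theta_projective i : projective (Theta i).
Proof. exact: split_projective (pm_Theta_simple Xg i) (Theta_split i). Qed.

(** Some term of the dominating decomposition of [idm V] is nonzero and factors through a simple
    object, so [simple_iso] applies. *)
Lemma simple_iso_Theta V : deg g V -> simple V ->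
  exists p : 'I_(rk C g) * Z, iso_obj V (Theta p.1 ⊗ sigma C p.2).
Proof.
move=> dV sV; have [n [x [s [io idE]]]] := pm_Theta_dominating Xg dV.
have [a /eqP ios|io0] := pickP (fun a => io a ∘ s a != 0).
  exists (x a); apply: simple_iso (s a) (io a) sV _ ios.
  exact: Theta_sigma_simple.
case: (simple_id_neq0 sV); rewrite idE big1 // => a _.
exact/eqP/negbFE/io0.
Qed.

(** An empty dominating set would make every identity in degree [g] zero. *)
Lemma rk_gt0 : (0 < rk C g)%N.
Proof.
rewrite lt0n; apply/eqP => rk0.
have [V dV] := grading_nonzero (pm_grading C) g; apply.
have [n [x [s [io ->]]]] := pm_Theta_dominating Xg dV.
rewrite big1 // => a _.
by have := ltn_ord (x a).1; rewrite [X in (_ < X)%N]rk0.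
Qed.

Lemma Theta_dual_inj i j (W : C) l l' :
  iso_obj (dual (Theta i)) (W ⊗ sigma C l) ->
  iso_obj (dual (Theta j)) (W ⊗ sigma C l') -> i = j.
Proof.
move=> isoi isoj; apply/eqP/negPn/negP => ij.
(* The shift [l - l'] carries [W ⊗ sigma l'] to [W ⊗ sigma l]. If [i] and [j] differ, transposing
   duals makes all endomorphisms of [dual (Theta i)] vanish, against simplicity. *)
have isoij : iso_obj (dual (Theta j) ⊗ sigma C (l - l')) (dual (Theta i)).
  apply: iso_trans (iso_tens isoj (iso_refl _)) _.
  apply: iso_trans (iso_assoc _ _ _) _; apply: iso_trans (iso_sym isoi).
  apply: iso_tens (iso_refl _) (iso_eq _).
  by rewrite (sigmaD (pm_sigma C)) addrC subrK.
apply: (simple_id_neq0 (simple_dual (pm_Theta_simple Xg i))).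
move: (idm _); apply: iso_hom_eq0 (iso_refl _) isoij _.
apply: hom_dual_eq0; apply: iso_hom_eq0 (iso_tens_sigma0 _) (iso_refl _) _.
by apply: Theta_sigma_hom_eq0; rewrite xpair_eqE negb_and eq_sym ij.
Qed.

Lemma mtr_Phi_Theta j (U : C) :
  mtr (Phi U (Theta j)) = mtr (monodromy (Theta j) U).
Proof. by rewrite (mtrace_ptr (pm_mtrace C)) //; apply: Theta_projective. Qed.

Lemma mtr_Theta_scalar j a : mtr (a *: idm (Theta j)) = a * mdim (Theta j).
Proof. by rewrite (mtrZ (pm_mtrace C)) //; apply: Theta_projective. Qed.

Lemma mdim_Theta_neq0 :
  invertible_mx (Smx C g g) -> forall j, mdim (Theta j) != 0.
Proof.
case=> B [_ BS] j; apply/eqP => d0; have /eqP := oner_neq0 k; apply.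
have /matrixP/(_ j j) := BS; rewrite mxE [RHS]mxE eqxx mulr1n => <-.
apply: big1 => i _; rewrite mxE.
have [a ->] := simple_scalar (Phi (Theta i) (Theta j)) (pm_Theta_simple Xg j).
by rewrite mtr_Theta_scalar d0 !mulr0.
Qed.

(** The factor is [psi h l] times the sign of the quantum dimension. It depends on [h] and [l] only,
    so it is common to a whole row of an S-matrix. *)
Lemma mtr_monodromy_sigma (h : G) l :
  exists2 a, a != 0 & forall V (Y : C), projective V -> deg h Y ->
    mtr (monodromy (V ⊗ sigma C l) Y) = a * mtr (monodromy V Y).
Proof.
have [psi [psi0 _ _] psiP] := pm_compat C.
have [a a0 qdimE] : exists2 a : k, a != 0 & qdim (sigma C l) = a *: idm tunit.
  have [->|->] := sigma_qdim (pm_sigma C) l.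
    by exists 1; rewrite ?oner_eq0 // scale1r.
  by exists (-1); rewrite ?oppr_eq0 ?oner_eq0 // scaleN1r.
exists (psi h l * a) => [|V Y pV dY]; first by rewrite mulf_neq0.
rewrite -mulrA; apply: (mtr_monodromy_transparent (pm_mtrace C)) => //.
exact: psiP.
Qed.

Lemma twist_scalar_neq0 i t : twist (Theta i) = t *: idm (Theta i) -> t != 0.
Proof.
move=> tE; apply/eqP => t0; apply: (simple_id_neq0 (pm_Theta_simple Xg i)).
by rewrite -twistK tE t0 scale0r comp0r.
Qed.

End Premodular.

(** * Kernel vectors of the S-matrices and non-degeneracy *)

Lemma row_mul_invertible0 (k : fieldType) m n (y : 'rV[k]_m) (A : 'M[k]_(m, n)) :
  invertible_mx A -> y *m A = 0 -> y = 0.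
Proof. by case=> B [AB _] yA; rewrite -[y]mulmx1 -AB mulmxA yA mul0mx. Qed.

Theorem theorem1p1 (k : fieldType) (G Z : zmodType) (X : G -> Prop)
  (X_symmetric : symmetric_subset X) (X_small : small_subset X)
  (C : premodular k Z X)
  (Delta_minus Delta_plus : k)
  (Delta_minusP : is_Delta_minus C Delta_minus)
  (Delta_plusP : is_Delta_plus C Delta_plus) :
  (exists g : G,
     [/\ ~ X g, invertible_mx (Smx C g g) & invertible_mx (Smx C (- g) g)]) ->
  Delta_plus * Delta_minus != 0.
Proof.
case=> g [Xg Sg Sgg]; have Xng : ~ X (- g) by move/X_symmetric; rewrite opprK.
have d0 := mdim_Theta_neq0 Xg Sg.
have /fin_all_exists [t tE] (i : 'I_(rk C g)) :
    exists t, twist (Theta i) = t *: idm (Theta i).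
  exact: simple_scalar (pm_Theta_simple Xg i).
have t0 i : t i != 0 := twist_scalar_neq0 Xg (tE i).
pose i0 := Ordinal (rk_gt0 C Xg).
have sT (i : 'I_(rk C g)) : simple (Theta i) by apply: pm_Theta_simple.
have pT (i : 'I_(rk C g)) : projective (Theta i) by apply: Theta_projective.
have dT (i : 'I_(rk C g)) : deg g (Theta i) by apply: pm_Theta_deg.
have trE := pm_mtrace C.
rewrite mulf_eq0 negb_or; apply/andP; split; apply/eqP => D0.
  have /fin_all_exists [p pP] (i : 'I_(rk C g)) :
      exists p : 'I_(rk C (- g)) * Z,
        iso_obj (dual (Theta i)) (Theta p.1 ⊗ sigma C p.2).
    apply: simple_iso_Theta => //.
      exact: (grading_dual (pm_grading C)).
    exact: simple_dual.
  have p_inj i j : (p i).1 = (p j).1 -> i = j.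
    by move=> pij; have := pP j; rewrite -pij; apply: Theta_dual_inj (pP i).
  have pTn (i : 'I_(rk C (- g))) : projective (Theta i).
    exact: Theta_projective.
  have /fin_all_exists2 [u u0 uE] (i : 'I_(rk C g)) : exists2 u, u != 0 &
      forall j : 'I_(rk C g),
        mtr (Phi (dual (Theta i)) (Theta j)) = u * Smx C (- g) g (p i).1 j.
    have [a a0 aE] := mtr_monodromy_sigma C g (p i).2.
    exists a => // j; rewrite mtr_Phi_Theta // (mtr_monodromyC trE) //.
    rewrite (mtr_monodromy_iso trE _ (pP i)) // aE // mxE mtr_Phi_Theta //.
    by rewrite (mtr_monodromyC trE).
  (* Summing over the fibre of [m] makes [y] zero off the image of [i |-> (p i).1]; on the image the
     fibre is a single index. *)
  pose y := \row_m \sum_(i | (p i).1 == m) mdim (Theta i) * t i * u i.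
  have y0 : y = 0.
    apply: row_mul_invertible0 Sgg _; apply/rowP => j; rewrite !mxE.
    have := Delta_plusP g Xg t tE (Theta j) (dT j); rewrite D0 scale0r.
    (* Cancelling the invertible twist leaves a vanishing sum of the [Phi], to which the m-trace is
       applied. *)
    move/(congr1 (fun f => twistI (Theta j) ∘ f)).
    rewrite comp_assoc twistK comp_idl comp0r => /(congr1 (fun f => mtr f)).
    rewrite (mtr0 trE (pT j)) (mtr_sum trE _ (pT j)) => sum0.
    rewrite -[RHS]sum0 [RHS](partition_big (fun i => (p i).1) xpredT) //=.
    apply: eq_bigr => m _; rewrite [y 0 m]mxE mulr_suml.
    apply: eq_bigr => i /eqP <-.
    by rewrite (mtrZ trE _ _ (pT j)) uE mulrA.
  (* By injectivity this entry is the single term of [i0], a product of nonzero scalars. *)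
  have /rowP/(_ (p i0).1) := y0; rewrite !mxE (big_pred1 i0) => [/eqP|i].
    by rewrite !mulf_eq0 (negPf (d0 _)) (negPf (t0 _)) (negPf (u0 _)).
  by rewrite /=; apply/eqP/eqP => [/p_inj|->].
(* Case [Delta_minus = 0]: the coefficients of its relation form a kernel row of [Smx C g g]
   directly. *)
pose y := \row_i (mdim (Theta i) * (t i)^-1).
have y0 : y = 0.
  apply: row_mul_invertible0 Sg _; apply/rowP => j; rewrite !mxE.
  have := Delta_minusP g Xg t tE (Theta j) (dT j); rewrite D0 scale0r.
  move/(congr1 (fun f => twist (Theta j) ∘ f)).
  rewrite comp_assoc twistIK comp_idl comp0r => /(congr1 (fun f => mtr f)).
  rewrite (mtr0 trE (pT j)) (mtr_sum trE _ (pT j)) => sum0; rewrite -[RHS]sum0.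
  by apply: eq_bigr => i _; rewrite (mtrZ trE _ _ (pT j)) !mxE.
have /rowP/(_ i0) := y0; rewrite !mxE => /eqP.
by rewrite mulf_eq0 invr_eq0 (negPf (d0 _)) (negPf (t0 _)).
Qed.
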